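(* Let $F$ be a field of characteristic $2$, let $m \geq 1$ be an integer, let $p$ be an odd prime, and set $n := 2p^m$. Let $x_1, \dots, x_n$ be independent variables over $F$, let $K_n := F(x_1, \dots, x_n)^{S_n}$ and $L_n := F(x_1, \dots, x_n)^{S_{n-1}}$. Then there is no $y \in L_n \setminus K_n$ such that $\mathrm{Tr}(y) = \mathrm{Tr}(y^2) = \dots = \mathrm{Tr}(y^p) = 0$.
   Context: The symmetric group $S_n$ acts on the rational function field $F(x_1,\dots,x_n)$ by permuting $x_1,\dots,x_n$, and $S_{n-1}\subset S_n$ is the subgroup permuting $x_2,\dots,x_n$ (fixing $x_1$). Thus $K_n = F(a_1,\dots,a_n)$ with $a_i$ the $i$-th elementary symmetric polynomial in $x_1,\dots,x_n$, and $L_n = K_n(x_1)$ is a separable field extension of $K_n$ of degree $n$. For $z\in L_n$, $\mathrm{Tr}(z)\in K_n$ denotes the trace of the $K_n$-linear map $L_n\to L_n$, $w\mapsto zw$ (i.e. the field trace of $L_n/K_n$). *)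

(* Defs.v *)
From HB Require Import structures.
From mathcomp Require Import all_boot all_order all_fingroup all_algebra all_field.
From mathcomp Require Import generic_quotient.
From mathcomp.multinomials Require Import mpoly.

Set Implicit Arguments.
Unset Strict Implicit.
Unset Printing Implicit Defensive.

Import GRing.Theory passmx.
Local Open Scope ring_scope.

Notation "x %:F" := (FracField.tofrac x) : ring_scope.

Section Trace.
Variable K : fieldType.

Definition lftrace (V : vectType K) (f : 'End(V)) : K :=
  \tr (mxof (vbasis {:V}) (vbasis {:V}) f).

Lemma lftrace_basis (V : vectType K) (e : (\dim {:V}).-tuple V) (f : 'End(V)) :
  basis_of {:V} e -> lftrace f = \tr (mxof e e f).
Proof.
move=> eB; have bB := vbasisP {:V}; set b := vbasis {:V} in bB *.
have E : mxof e e f = mxof e b \1%VF *m mxof b b f *m mxof b e \1%VF.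
  apply/row_matrixP => i; rewrite !rowE !mulmxA !mul_mxof !lfunE /=.
  by rewrite !rVofK.
rewrite E mxtrace_mulC mulmxA (_ : mxof b e \1%VF *m _ = 1%:M) ?mul1mx //.
apply/row_matrixP => i; rewrite !rowE !mulmxA !mul_mxof !lfunE /=.
by rewrite rVofK // vecofK // mulmx1.
Qed.

Definition fieldTrace (L : fieldExtType K) (z : L) : K := lftrace (amull z).

End Trace.

Section SubField.
Variables (E : fieldType) (S : divringClosed E).

Record subfieldOf := SubfieldOf { subfieldOf_val :> E; _ : subfieldOf_val \in S }.
HB.instance Definition _ := [isSub for subfieldOf_val].
HB.instance Definition _ := [Choice of subfieldOf by <:].
HB.instance Definition _ := [SubChoice_isSubComUnitRing of subfieldOf by <:].
HB.instance Definition _ := [SubComUnitRing_isSubIntegralDomain of subfieldOf by <:].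
HB.instance Definition _ := [SubIntegralDomain_isSubField of subfieldOf by <:].

End SubField.

Lemma fraction_repr (R : idomainType) (f : {fraction R}) :
  f = (\n_(repr f))%:F / (\d_(repr f))%:F.
Proof.
have d0 := denom_ratioP (repr f); set x := repr f in d0 *.
apply: (canRL (mulfK _)); first by rewrite tofrac_eq0.
rewrite -[f]reprK -/x; unlock FracField.tofrac; rewrite -[LHS]FracField.pi_mul.
apply/eqmodP; rewrite /= FracField.equivfE /FracField.mulf.
by rewrite !numden_Ratio ?mulf_neq0 ?oner_eq0 // !mulr1 mulrC.
Qed.

Section RationalFunctions.
Variables (F : fieldType) (n : nat).

Definition ratfun : fieldType := {fraction {mpoly F[n]}}.

Implicit Types (p q : {mpoly F[n]}) (f g : ratfun) (s t : 'S_n).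

Definition ratvar (j : 'I_n) : ratfun := ('X_j : {mpoly F[n]})%:F.

(* The unique extension of msym s, 'X_j |-> 'X_(s j), to the fraction field:  *)
(* it does not depend on the representative, see ratfun_actE.                 *)
Definition ratfun_act s f : ratfun :=
  (msym s \n_(repr f))%:F / (msym s \d_(repr f))%:F.

Lemma msym_eq0 s p : (msym s p == 0) = (p == 0).
Proof. by rewrite -[X in _ == X](msym0 F s) (inj_eq (inj_msym s)). Qed.

Lemma ratfun_repr f : f = (\n_(repr f))%:F / (\d_(repr f))%:F.
Proof. exact: fraction_repr. Qed.

Lemma ratfun_actE s p q : q != 0 ->
  ratfun_act s (p%:F / q%:F) = (msym s p)%:F / (msym s q)%:F.
Proof.
move=> q0; set f : ratfun := _ / _; have d0 := denom_ratioP (repr f).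
rewrite /ratfun_act; apply/eqP.
rewrite eqr_div ?tofrac_eq0 ?msym_eq0 // -!tofracM -!msymM tofrac_eq.
rewrite (inj_eq (inj_msym s)) -tofrac_eq !tofracM -eqr_div ?tofrac_eq0 //.
by rewrite -ratfun_repr.
Qed.

Lemma ratfunP f : exists p q, q != 0 /\ f = p%:F / q%:F.
Proof.
exists \n_(repr f), \d_(repr f); split; [exact: denom_ratioP | exact: ratfun_repr].
Qed.

Lemma ratfun_act_tofrac s p : ratfun_act s p%:F = (msym s p)%:F.
Proof.
by rewrite -[p%:F]divr1 -tofrac1 ratfun_actE ?oner_eq0 // msym1 tofrac1 divr1.
Qed.

Fact ratfun_act_zmod s : zmod_morphism (ratfun_act s).
Proof.
move=> f g; have [p [q [q0 ->]]] := ratfunP f; have [p' [q' [q'0 ->]]] := ratfunP g.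
rewrite -mulNr addf_div ?tofrac_eq0 // -tofracN -!tofracM -tofracD.
rewrite !ratfun_actE ?mulf_neq0 // -mulNr addf_div ?tofrac_eq0 ?msym_eq0 //.
by rewrite msymD !msymM msymN tofracD !tofracM tofracN.
Qed.

Fact ratfun_act_monoid s : monoid_morphism (ratfun_act s).
Proof.
split=> [|f g]; first by rewrite -tofrac1 ratfun_act_tofrac msym1.
have [p [q [q0 ->]]] := ratfunP f; have [p' [q' [q'0 ->]]] := ratfunP g.
rewrite mulf_div -!tofracM !ratfun_actE ?mulf_neq0 //.
by rewrite !msymM !tofracM mulf_div.
Qed.

HB.instance Definition _ s :=
  GRing.isZmodMorphism.Build ratfun ratfun (ratfun_act s) (ratfun_act_zmod s).
HB.instance Definition _ s :=
  GRing.isMonoidMorphism.Build ratfun ratfun (ratfun_act s) (ratfun_act_monoid s).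

Lemma ratfun_act1 f : ratfun_act 1%g f = f.
Proof.
by have [p [q [q0 ->]]] := ratfunP f; rewrite ratfun_actE // !msym1m.
Qed.

Lemma ratfun_actM s t f : ratfun_act (s * t)%g f = ratfun_act t (ratfun_act s f).
Proof.
have [p [q [q0 ->]]] := ratfunP f.
have fd u g h : ratfun_act u (g / h) = ratfun_act u g / ratfun_act u h.
  exact: fmorph_div.
have E r : ratfun_act (s * t)%g r%:F = ratfun_act t (ratfun_act s r%:F).
  by rewrite (ratfun_act_tofrac s) (ratfun_act_tofrac t) ratfun_act_tofrac msymMm.
by rewrite (fd s) (fd t) (fd (s * t)%g) (E p) (E q).
Qed.

Lemma ratfun_act_var s j : ratfun_act s (ratvar j) = ratvar (s j).
Proof. by rewrite /ratvar ratfun_act_tofrac /msym mmapX mmap1U. Qed.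

Lemma ratvar_inj : injective ratvar.
Proof.
move=> j k /eqP; rewrite tofrac_eq => /eqP /(congr1 (mcoeff U_(j))).
by rewrite !mcoeffXU eqxx; case: eqP => // _ /eqP; rewrite oner_eq0.
Qed.

Section Invariants.
Variable A : {set 'S_n}.

Definition invRatfun : {pred ratfun} :=
  fun f => [forall s in A, ratfun_act s f == f].

Lemma invRatfunP f :
  reflect (forall s, s \in A -> ratfun_act s f = f) (f \in invRatfun).
Proof. exact: 'forall_in_eqP. Qed.

Fact invRatfun_divring : divring_closed invRatfun.
Proof.
split=> [|f g|f g].
- by apply/invRatfunP => s _; rewrite rmorph1.
- move=> /invRatfunP fA /invRatfunP gA; apply/invRatfunP => s sA.
  by rewrite rmorphB /= fA ?gA.
- move=> /invRatfunP fA /invRatfunP gA; apply/invRatfunP => s sA.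
  by rewrite fmorph_div /= fA ?gA.
Qed.
HB.instance Definition _ := GRing.isDivringClosed.Build ratfun invRatfun
  invRatfun_divring.

End Invariants.

Definition symField : fieldType := subfieldOf (invRatfun [set: 'S_n]).
Definition symField_val (k : symField) : ratfun := subfieldOf_val k.
HB.instance Definition _ := GRing.RMorphism.copy symField_val
  (val : subfieldOf (invRatfun [set: 'S_n]) -> ratfun).

Section Stabiliser.
Variable i : 'I_n.

Definition stabField : Type := subfieldOf (invRatfun [set s : 'S_n | s i == i]).
HB.instance Definition _ := SubType.on stabField.
HB.instance Definition _ := GRing.Field.on stabField.
Definition stabField_val (z : stabField) : ratfun := subfieldOf_val z.
HB.instance Definition _ := GRing.RMorphism.copy stabField_val
  (val : subfieldOf (invRatfun [set s : 'S_n | s i == i]) -> ratfun).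

Implicit Types (k l : symField) (z w : stabField).

Lemma symField_val_inj : injective symField_val.
Proof. exact: val_inj. Qed.

Lemma stabField_val_inj : injective stabField_val.
Proof. exact: val_inj. Qed.

Lemma symField_fixed k s : ratfun_act s (symField_val k) = symField_val k.
Proof. by have /invRatfunP-> := valP k; rewrite ?inE. Qed.

Lemma stabField_fixed z s : s i = i -> ratfun_act s (stabField_val z) = stabField_val z.
Proof. by move=> si; have /invRatfunP-> := valP z; rewrite ?inE ?si. Qed.

Fact sym_stab_subproof k : symField_val k \in invRatfun [set s : 'S_n | s i == i].
Proof. by apply/invRatfunP => s _; rewrite symField_fixed. Qed.

Definition sym_stab k : stabField := SubfieldOf (sym_stab_subproof k).

Fact sym_stab_zmod : zmod_morphism sym_stab.
Proof.
move=> k l; apply: stabField_val_inj.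
by rewrite rmorphB [LHS](rmorphB symField_val).
Qed.
Fact sym_stab_monoid : monoid_morphism sym_stab.
Proof.
split=> [|k l]; apply: stabField_val_inj.
  by rewrite rmorph1 [LHS](rmorph1 symField_val).
by rewrite rmorphM [LHS](rmorphM symField_val).
Qed.
HB.instance Definition _ :=
  GRing.isZmodMorphism.Build symField stabField sym_stab sym_stab_zmod.
HB.instance Definition _ :=
  GRing.isMonoidMorphism.Build symField stabField sym_stab sym_stab_monoid.

Definition sym_scale k z : stabField := sym_stab k * z.

Fact sym_scaleA k l z : sym_scale k (sym_scale l z) = sym_scale (k * l) z.
Proof. by rewrite /sym_scale rmorphM mulrA. Qed.
Fact sym_scale1 : left_id 1 sym_scale.
Proof. by move=> z; rewrite /sym_scale rmorph1 mul1r. Qed.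
Fact sym_scaleDr : right_distributive sym_scale +%R.
Proof. by move=> k z w; rewrite /sym_scale mulrDr. Qed.
Fact sym_scaleDl z : {morph sym_scale^~ z : k l / k + l}.
Proof. by move=> k l; rewrite /sym_scale rmorphD mulrDl. Qed.
HB.instance Definition _ := GRing.Zmodule_isLmodule.Build symField stabField
  sym_scaleA sym_scale1 sym_scaleDr sym_scaleDl.

Fact sym_scaleAl k z w : k *: (z * w) = k *: z * w.
Proof. exact: mulrA. Qed.
HB.instance Definition _ :=
  GRing.Lmodule_isLalgebra.Build symField stabField sym_scaleAl.
Fact sym_scaleAr k z w : k *: (z * w) = z * (k *: w).
Proof. exact: mulrCA. Qed.
HB.instance Definition _ :=
  GRing.Lalgebra_isAlgebra.Build symField stabField sym_scaleAr.

Lemma val_sym_scale k z :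
  stabField_val (k *: z) = symField_val k * stabField_val z.
Proof. exact: rmorphM. Qed.

(* The powers x_i ^+ r, r < n, form a basis of stabField over symField: the   *)
(* coordinates of z are the coefficients of the polynomial of degree < n      *)
(* sending each x_j to the conjugate of z by tperm i j.                       *)
Definition conjugates z : 'rV[ratfun]_n :=
  \row_j ratfun_act (tperm i j) (stabField_val z).

Definition varVandermonde : 'M[ratfun]_n := Vandermonde n (\row_j ratvar j).

Lemma varVandermondeE r j : varVandermonde r j = ratvar j ^+ r.
Proof. by rewrite !mxE. Qed.

Lemma varVandermonde_unit : varVandermonde \in unitmx.
Proof.
rewrite unitmxE unitfE det_Vandermonde; apply/prodf_neq0 => j _.
apply/prodf_neq0 => k ltjk; rewrite !mxE subr_eq0 (inj_eq ratvar_inj).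
by rewrite -val_eqE /= gtn_eqF.
Qed.

Definition stab_coef z : 'rV[ratfun]_n := conjugates z *m invmx varVandermonde.

Fact stab_coef_inv z j : stab_coef z 0 j \in invRatfun [set: 'S_n].
Proof.
apply/invRatfunP => s _.
have actV : map_mx (ratfun_act s) varVandermonde = col_perm s varVandermonde.
  by apply/matrixP => r c; rewrite !mxE rmorphXn /= ratfun_act_var.
have actz : map_mx (ratfun_act s) (conjugates z) = col_perm s (conjugates z).
  apply/rowP => c; rewrite !mxE -ratfun_actM.
  rewrite -[(tperm i c * s)%g](mulgKV (tperm i (s c))) ratfun_actM.
  rewrite stabField_fixed // !permM !tpermL /=.
  by rewrite tpermV tpermR.
have Vs_unit : col_perm s varVandermonde \in unitmx.
  by rewrite col_permE unitmx_mul varVandermonde_unit unitmx_perm.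
suff /(congr1 (fun c : 'rV_n => c 0 j)) : stab_coef z = map_mx (ratfun_act s) (stab_coef z).
  by rewrite [in RHS]mxE.
apply: (can_inj (mulmxK Vs_unit)).
rewrite -{2}actV -map_mxM mulmxKV ?varVandermonde_unit // actz.
by rewrite !col_permE mulmxA mulmxKV ?varVandermonde_unit.
Qed.

Definition stab_coord z : 'rV[symField]_n :=
  \row_j (SubfieldOf (stab_coef_inv z j) : symField).

Lemma stab_coordE z j : symField_val (stab_coord z 0 j) = stab_coef z 0 j.
Proof. by rewrite mxE. Qed.

Fact stab_var_subproof : ratvar i \in invRatfun [set s : 'S_n | s i == i].
Proof.
by apply/invRatfunP => s; rewrite inE ratfun_act_var => /eqP->.
Qed.
Definition stabVar : stabField := SubfieldOf stab_var_subproof.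

Definition stab_comb (c : 'rV[symField]_n) : stabField :=
  \sum_r c 0 r *: stabVar ^+ r.

Lemma val_stab_comb c :
  stabField_val (stab_comb c) = \sum_r symField_val (c 0 r) * ratvar i ^+ r.
Proof.
rewrite /stab_comb raddf_sum; apply: eq_bigr => r _.
by rewrite [LHS]val_sym_scale rmorphXn.
Qed.

Lemma stab_coordK : cancel stab_coord stab_comb.
Proof.
move=> z; apply: stabField_val_inj; rewrite val_stab_comb.
have /rowP/(_ i) : stab_coef z *m varVandermonde = conjugates z.
  by rewrite mulmxKV ?varVandermonde_unit.
rewrite [LHS]mxE [RHS]mxE tperm1 ratfun_act1 => <-; apply: eq_bigr => r _.
by rewrite stab_coordE varVandermondeE.
Qed.

Lemma stab_combK : cancel stab_comb stab_coord.
Proof.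
move=> c; apply/rowP => j; apply: symField_val_inj; rewrite stab_coordE.
suff -> : stab_coef (stab_comb c) = map_mx symField_val c by rewrite mxE.
apply: (canLR (mulmxK varVandermonde_unit)); apply/rowP => k.
rewrite [LHS]mxE [RHS]mxE val_stab_comb raddf_sum; apply: eq_bigr => r _.
rewrite [LHS]rmorphM [X in _ * X]rmorphXn /= symField_fixed ratfun_act_var tpermL.
by rewrite varVandermondeE mxE.
Qed.

Fact stab_coord_linear : linear stab_coord.
Proof.
move=> k z w; apply: (can_inj stab_combK); rewrite stab_coordK.
rewrite -{1}[z]stab_coordK -{1}[w]stab_coordK /stab_comb scaler_sumr -big_split.
by apply: eq_bigr => r _; rewrite /= [in RHS]mxE [in RHS]mxE scalerDl scalerA.
Qed.

Fact stabField_vector_axiom : Vector.axiom n stabField.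
Proof.
by exists stab_coord; [exact: stab_coord_linear
  | exists stab_comb; [exact: stab_coordK | exact: stab_combK]].
Qed.
HB.instance Definition _ :=
  Lmodule_hasFinDim.Build symField stabField stabField_vector_axiom.

Lemma dim_stabField : \dim {:stabField} = n.
Proof. by rewrite dimvf. Qed.

End Stabiliser.

End RationalFunctions.

(* Main.v *)
From HB Require Import structures.
Require Import Defs.
From mathcomp Require Import all_boot all_order all_fingroup all_algebra all_field.
From mathcomp.multinomials Require Import mpoly.

Set Implicit Arguments.
Unset Strict Implicit.
Unset Printing Implicit Defensive.

Import GRing.Theory passmx.
Local Open Scope ring_scope.

(* Index the variables by two copies of T = (Z/p)^m, so that T x T embeds in   *)
(* S_n, and adjoin a p-th root of unity to F. The conjugates of y have a       *)
(* common symmetric denominator; let P_j be their numerators. Over the         *)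
(* extension a Fourier transform of the variables makes T x T act diagonally   *)
(* on monomials. If the P_j are not all equal, let u be the largest monomial   *)
(* where two of them differ and c_j the coefficient of u in P_j. The power     *)
(* sums of P_j - P_j0 vanish (n is even), hence so do those of the c_j, and    *)
(* c is an eigenvector of T x T. If its character is trivial, c is constant    *)
(* on each copy of T, and sum c_j = 0 makes the two constants equal. If it is  *)
(* nontrivial on one copy of T, c vanishes on the other copy and c_j ^ p is    *)
(* constant on the first, so sum c_j ^ p = 0 forces c = 0, as #|T| is odd.     *)

(** The trace of y ^ k is the k-th power sum of the n conjugates of y ([fieldTrace_sum_conj]).
    Clearing a symmetric denominator ([conj_common_denominator]) leaves polynomials that S_n
    permutes as it permutes the variables. Such a family, if its power sums of exponents 1 to p
    vanish, is constant ([equivariant_power_sums_const]), so y is symmetric. That step passes from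
    polynomials to their coefficients at one top monomial, where [fourier_shift] makes translations
    act by scalars whose p-th power is 1; raising to the power p erases these scalars, and
    [eigenvector_const] concludes. *)

Lemma pchar2_natr (R : nzRingType) (k : nat) :
  2%N \in [pchar R] -> k%:R = (odd k)%:R :> R.
Proof.
move=> c2; rewrite -{1}[k]odd_double_half natrD -muln2 natrM (pcharf0 c2).
by rewrite mulr0 addr0.
Qed.

(** In the binomial expansion, the only term without a power sum of [d] is [a ^+ k] summed [#|I|]
    times, which vanishes. This allows translating a family by a common constant, and back. *)
Lemma sum_exprD_eq0 (R : comNzRingType) (I : finType) (d : I -> R) (a : R) (p : nat) :
  (forall k, (1 <= k <= p)%N -> \sum_i d i ^+ k = 0) -> #|I|%:R = 0 :> R ->
  forall k, (k <= p)%N -> \sum_i (a + d i) ^+ k = 0.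
Proof.
move=> d0 I0 k le_kp; under eq_bigr do rewrite exprDn.
rewrite exchange_big big1 //= => j _; rewrite sumrMnl -mulr_sumr.
have [-> | j_gt0] := posnP (val j).
  by rewrite sumr_const cardE -cardT I0 mulr0 mul0rn.
by rewrite d0 ?mulr0 ?mul0rn // j_gt0 (leq_trans _ le_kp) // -ltnS.
Qed.

(** [chi b s] is the eigenvalue of translation by [s] on copy [b], a move that leaves copy [~~ b]
    pointwise fixed: hence the pair [shift_c], [fix_c]. *)
Lemma eigenvector_const (K : fieldType) (T : finZmodType) (p : nat)
    (c : bool * T -> K) (chi : bool -> T -> K) :
  2%N \in [pchar K] -> odd #|T| -> (0 < p)%N ->
  (forall b s t, c (b, t + s) = chi b s * c (b, t)) ->
  (forall b s t, c (~~ b, t) = chi b s * c (~~ b, t)) ->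
  (forall b s, chi b s ^+ p = 1) ->
  \sum_i c i = 0 -> \sum_i c i ^+ p = 0 -> forall i j, c i = c j.
Proof.
move=> c2 oddT p_gt0 shift_c fix_c chiX sum_c sum_cX.
have T1 : #|T|%:R = 1 :> K by rewrite (pchar2_natr _ c2) oddT.
have neq_negb (b1 b2 : bool) : b1 != b2 -> b1 = ~~ b2 by case: b1; case: b2.
have sum_const (a : K) : \sum_(t : T) a = a.
  by rewrite sumr_const -mulr_natl T1 mul1r.
have sum_pair (f : bool * T -> K) : \sum_i f i = \sum_b \sum_t f (b, t).
  by rewrite pair_bigA; apply: eq_bigr => -[].
have [/existsP[b /existsP[s chi_neq1]] | triv] :=
    boolP [exists b, exists s, chi b s != 1]; last first.
  have chi1 b s : chi b s = 1.
    by apply/eqP; apply: contraR triv => ne1; apply/existsP; exists b; apply/existsP; exists s.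
  have c_orb b t : c (b, t) = c (b, 0).
    by rewrite -{1}[t]add0r shift_c chi1 mul1r.
  (* As [#|T|] is odd, the sum of [c] is the sum of its two constant values. *)
  have c_eq : c (true, 0) = c (false, 0).
    have /eqP := sum_c; rewrite sum_pair big_bool /=.
    do 2![under eq_bigr do rewrite c_orb; rewrite sum_const].
    by rewrite addr_eq0 oppr_pchar2 // => /eqP.
  by case=> [[] s] [[] t]; rewrite [LHS]c_orb [RHS]c_orb.
have c_off t : c (~~ b, t) = 0.
  apply/eqP; have /eqP := fix_c b s t; rewrite -subr_eq0 -{1}[c _]mul1r -mulrBl.
  by rewrite mulf_eq0 subr_eq0 eq_sym (negPf chi_neq1).
have c_on t : c (b, t) ^+ p = c (b, 0) ^+ p.
  by rewrite -{1}[t]add0r shift_c exprMn chiX mul1r.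
have c_on0 : c (b, 0) ^+ p = 0.
  rewrite -sum_cX sum_pair (bigD1 b) //=.
  rewrite [X in _ + X]big1 ?addr0 => [|b' nb]; last first.
    by apply: big1 => t _; rewrite (neq_negb _ _ nb) c_off expr0n eqn0Ngt p_gt0.
  by under eq_bigr do rewrite c_on; rewrite sum_const.
suff c0 i : c i = 0 by move=> i j; rewrite !c0.
case: i => b' t; have [-> | nb] := eqVneq b' b.
  by apply/eqP; move/eqP: (c_on t); rewrite c_on0 expf_eq0 p_gt0.
by rewrite (neq_negb _ _ nb).
Qed.

(** * Leading monomials and diagonal substitutions *)

Lemma mpoly_rmorph_eq (n : nat) (R S : comNzRingType)
    (f g : {rmorphism {mpoly R[n]} -> S}) :
  (forall c, f c%:MP = g c%:MP) -> (forall i, f 'X_i = g 'X_i) -> f =1 g.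
Proof.
move=> fgC fgX q; rewrite [q]mpolyE !rmorph_sum; apply: eq_bigr => m _ /=.
rewrite -mul_mpolyC !rmorphM /= fgC mpolyXE_id !rmorph_prod; congr (_ * _).
by apply: eq_bigr => i _; rewrite !rmorphXn /= fgX.
Qed.

(** Here [u] only bounds the leading monomial and its coefficient may be zero, so one [u] serves a
    whole family. *)
Lemma mleadXW (n : nat) (R : nzRingType) (q : {mpoly R[n]}) (u : 'X_{1..n}) k :
  (mlead q <= u)%O ->
  (mlead (q ^+ k) <= (u *+ k)%MM)%O /\ (q ^+ k)@_(u *+ k)%MM = q@_u ^+ k.
Proof.
move=> le_qu; elim: k => [|k [le_k eq_k]].
  by rewrite !expr0 mulm0n mlead1 mcoeff1 eqxx.
rewrite !exprS !mulmS mleadcMW // eq_k; split=> //.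
exact: Order.POrderTheory.le_trans (mleadM_le _ _) (lem_add le_qu le_k).
Qed.

Section Diagonal.

Variables (n : nat) (R : comNzRingType).
Implicit Types (w : 'I_n -> R) (q : {mpoly R[n]}).

Definition diag_scale w q : {mpoly R[n]} := mmap (@mpolyC n R) (fun i => w i *: 'X_i) q.

HB.instance Definition _ w := GRing.RMorphism.copy (diag_scale w)
  (mmap (@mpolyC n R) (fun i => w i *: 'X_i)).

Lemma mcoeff_diag_scale w q u : (diag_scale w q)@_u = mmap1 w u * q@_u.
Proof.
rewrite {2}[q]mpolyE /diag_scale /mmap !raddf_sum mulr_sumr; apply: eq_bigr => m _ /=.
have -> : mmap1 (fun i => w i *: 'X_i) m = mmap1 w m *: 'X_[m] :> {mpoly R[n]}.
  rewrite mpolyXE_id /mmap1 -scaler_prod; apply: eq_bigr => i _.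
  by rewrite exprZn.
rewrite mul_mpolyC !mcoeffZ mcoeffX; case: eqP => [-> | _]; last by rewrite !mulr0.
by rewrite !mulr1 mulrC.
Qed.

End Diagonal.

(** * Characters of (Z/p)^m *)

Section Pairing.

Variables (K : fieldType) (p m : nat) (zeta : K).
Hypotheses (p_prime : prime p) (zetaX : zeta ^+ p = 1) (zeta_neq1 : zeta != 1).
Local Notation T := 'rV['F_p]_m.
Implicit Types a s t : T.

Definition pairing a t : K := zeta ^+ ((a *m t^T) 0 0).

Lemma pairingC a t : pairing a t = pairing t a.
Proof.
rewrite /pairing !mxE; congr (zeta ^+ (nat_of_ord _)).
by apply: eq_bigr => i _; rewrite !mxE mulrC.
Qed.

Lemma pairingDr a s t : pairing a (s + t) = pairing a s * pairing a t.
Proof.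
rewrite /pairing linearD /= mulmxDr mxE /= -exprD.
by rewrite expr_mod // (Fp_cast p_prime).
Qed.

Lemma pairingDl a b t : pairing (a + b) t = pairing a t * pairing b t.
Proof. by rewrite pairingC pairingDr !(pairingC t). Qed.

Lemma pairingX a t : pairing a t ^+ p = 1.
Proof. by rewrite /pairing exprAC zetaX expr1n. Qed.

Lemma pairing0 a : pairing a 0 = 1.
Proof. by rewrite /pairing trmx0 mulmx0 mxE expr0. Qed.

(** The witness has dot product 1 with [t], so the pairing is [zeta] itself. *)
Lemma pairing_neq1 t : t != 0 -> exists a, pairing a t != 1.
Proof.
case/rV0Pn => i ti; exists ((t 0 i)^-1 *: delta_mx 0 i).
by rewrite /pairing -scalemxAl mxE -rowE !mxE mulVf.
Qed.

Lemma pairing_sum t : \sum_a pairing a t = (#|T|%:R : K) *+ (t == 0).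
Proof.
have [-> | /pairing_neq1[b b_neq1]] := eqVneq t 0.
  by under eq_bigr do rewrite pairing0; rewrite sumr_const.
(* Translating the summation index by [b] multiplies the sum by a scalar other than 1. *)
set S := \sum_a _; have : (pairing b t - 1) * S = 0.
  rewrite mulrBl mul1r {2}/S (reindex_inj (addrI b)) /=.
  by under [X in _ - X]eq_bigr do rewrite pairingDl; rewrite -mulr_sumr subrr.
by move/eqP; rewrite mulf_eq0 subr_eq0 (negPf b_neq1) => /eqP.
Qed.

End Pairing.

(** * Fourier transform of the variables, diagonalizing translations *)

Section Fourier.

Variables (F K : fieldType) (iota : {rmorphism F -> K}) (p m : nat) (zeta : K).
Hypotheses (p_prime : prime p) (zetaX : zeta ^+ p = 1) (zeta_neq1 : zeta != 1).
Hypothesis T1 : #|'rV['F_p]_m|%:R = 1 :> K.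
Local Notation T := 'rV['F_p]_m.
Local Notation I := (bool * T)%type.
Local Notation n := #|{: I}|.
Local Notation chi := (pairing zeta).

Definition orbit_var (R : comNzRingType) (b : bool) (t : T) : {mpoly R[n]} := 'X_(enum_rank (b, t)).

Definition fourier_img (i : 'I_n) : {mpoly K[n]} :=
  \sum_a chi a (enum_val i).2 *: orbit_var K (enum_val i).1 a.

Definition fourier : {mpoly F[n]} -> {mpoly K[n]} := mmap (@mpolyC n K \o iota) fourier_img.
HB.instance Definition _ := GRing.RMorphism.copy fourier (mmap (@mpolyC n K \o iota) fourier_img).

Lemma fourierC c : fourier c%:MP = (iota c)%:MP.
Proof. exact: mmapC. Qed.

Lemma fourierX b t : fourier (orbit_var F b t) = \sum_a chi a t *: orbit_var K b a.
Proof. by rewrite /fourier /orbit_var mmapX mmap1U /fourier_img enum_rankK. Qed.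

Lemma fourier_inj : injective fourier.
Proof.
(* The inverse transform needs no factor [1 / #|T|], since [#|T|] is 1 in [K]; what remains of the
   composite is the scalar extension [iota]. *)
pose inv_img (i : 'I_n) : {mpoly K[n]} :=
  \sum_t chi (enum_val i).2 (- t) *: orbit_var K (enum_val i).1 t.
pose inv := mmap (@mpolyC n K) inv_img.
have invX b a : inv (orbit_var K b a) = \sum_t chi a (- t) *: orbit_var K b t.
  by rewrite /inv /orbit_var mmapX mmap1U /inv_img enum_rankK.
have eq_map : inv \o fourier =1 map_mpoly iota.
  apply: mpoly_rmorph_eq => [c | i] /=; first by rewrite fourierC /inv mmapC map_mpolyC.
  rewrite -(enum_valK i); case: (enum_val i) => b t.
  rewrite -[X in fourier X]/(orbit_var F b t) fourierX /inv raddf_sum /=.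
  under eq_bigr => a _.
    rewrite mmapZ -/inv invX mul_mpolyC scaler_sumr.
    under eq_bigr do rewrite scalerA -pairingDr //.
    over.
  rewrite exchange_big /= (bigD1 t) //= [X in _ + X]big1 ?addr0 => [|s ne_st].
    by rewrite -scaler_suml pairing_sum // subrr eqxx T1 scale1r map_mpolyX.
  by rewrite -scaler_suml pairing_sum // subr_eq0 eq_sym (negPf ne_st) scale0r.
move=> q r eq_qr; apply/mpolyP => u; apply: (fmorph_inj iota).
by rewrite -!mcoeff_map_mpoly -!eq_map /= eq_qr.
Qed.

Definition shift (b : bool) (s : T) (i : I) : I := (i.1, if i.1 == b then i.2 + s else i.2).

Lemma shift_inj b s : injective (shift b s).
Proof.
by case=> b1 t1 [b2 t2] [<-]; case: eqP => _ => [/addIr|] ->.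
Qed.

Lemma shift_rank_inj b s : injective (fun i : 'I_n => enum_rank (shift b s (enum_val i))).
Proof. by move=> i j /enum_rank_inj/shift_inj/enum_val_inj. Qed.

Definition shift_perm b s : 'S_n := perm (@shift_rank_inj b s).

Lemma shift_permE b s i : shift_perm b s (enum_rank i) = enum_rank (shift b s i).
Proof. by rewrite permE enum_rankK. Qed.

Definition shift_weight b s (i : 'I_n) : K :=
  if (enum_val i).1 == b then chi (enum_val i).2 s else 1.

Lemma fourier_shift b s q :
  fourier (msym (shift_perm b s) q) = diag_scale (shift_weight b s) (fourier q).
Proof.
move: q; apply: (mpoly_rmorph_eq (f := fourier \o msym (shift_perm b s))
   (g := diag_scale (shift_weight b s) \o fourier)) => [c | i] /=.
  by rewrite /msym mmapC !fourierC /diag_scale mmapC.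
rewrite -(enum_valK i); case: (enum_val i) => b' t.
rewrite /msym mmapX mmap1U shift_permE -/(orbit_var F _ _) /shift /=.
rewrite -!/(orbit_var F _ _) !fourierX raddf_sum; apply: eq_bigr => a _ /=.
rewrite /diag_scale mmapZ mmapX mmap1U mul_mpolyC scalerA /shift_weight enum_rankK /=.
by case: eqP => _; rewrite ?mulr1 // pairingDr.
Qed.

Lemma shift_weightX b s u : mmap1 (shift_weight b s) u ^+ p = 1.
Proof.
rewrite /mmap1 -prodrXl big1 // => i _; rewrite exprAC /shift_weight.
by case: ifP => _; rewrite ?pairingX // !expr1n.
Qed.

End Fourier.

(** * Equivariant families with vanishing power sums *)

Lemma equivariant_power_sums_const (F K : fieldType) (iota : {rmorphism F -> K})
    (p m : nat) (zeta : K)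
    (P : 'I_#|{: bool * 'rV['F_p]_m}| -> {mpoly F[#|{: bool * 'rV['F_p]_m}|]}) :
  2%N \in [pchar K] -> prime p -> odd p -> zeta ^+ p = 1 -> zeta != 1 ->
  (forall s j, msym s (P j) = P (s j)) ->
  (forall k, (1 <= k <= p)%N -> \sum_j P j ^+ k = 0) ->
  forall i j, P i = P j.
Proof.
move=> c2 p_prime odd_p zetaX zeta_neq1 sym_P sum_P i0 j0.
have oddT : odd #|'rV['F_p]_m| by rewrite card_mx card_Fp // oddX odd_p orbT.
have T1 : #|'rV['F_p]_m|%:R = 1 :> K by rewrite (pchar2_natr _ c2) oddT.
have cardI : #|'I_(#|{: bool * 'rV['F_p]_m}|)|%:R = 0 :> K.
  by rewrite card_ord card_prod card_bool natrM (pcharf0 c2) mul0r.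
pose C j := fourier iota zeta (P j).
apply: (fourier_inj p_prime zetaX zeta_neq1 T1 (iota := iota)).
rewrite -/(C i0) -/(C j0); apply/eqP; rewrite -subr_eq0; apply: contraT => D0.
(* Among the nonzero differences with [C j0], choose one whose leading monomial [u] is largest. *)
have [j Dj0 max_j] :=
  @Order.TotalTheory.arg_maxP _ _ _ i0 (fun j => C j - C j0 != 0) (fun j => mlead (C j - C j0)) D0.
set u := mlead _ in max_j.
have le_u i : (mlead (C i - C j0) <= u)%O.
  have [-> | /max_j //] := eqVneq (C i - C j0) 0.
  by rewrite mlead0 Order.BPreorderTheory.le0x.
pose c i := (C (enum_rank i))@_u.
have sum_C k : (1 <= k <= p)%N -> \sum_j C j ^+ k = 0.
  move=> k_p; transitivity (fourier iota zeta (\sum_j P j ^+ k)).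
    by rewrite raddf_sum; apply: eq_bigr => i _ /=; rewrite rmorphXn.
  by rewrite sum_P // raddf0.
have sum_D k : (k <= p)%N -> \sum_i (- C j0 + C i) ^+ k = 0.
  move=> le_k; apply: sum_exprD_eq0 sum_C _ _ le_k.
  by rewrite -mpolyC_nat cardI mpolyC0.
(* Since [u] bounds all the differences, the coefficient at [u *+ k] of a k-th power is the k-th
   power of the coefficient at [u]. *)
have sum_d k : (1 <= k <= p)%N -> \sum_i ((C i)@_u - (C j0)@_u) ^+ k = 0.
  move=> /andP[_ /sum_D/(congr1 (mcoeff (u *+ k)%MM))]; rewrite mcoeff0 raddf_sum /= => D_k.
  rewrite -[RHS]D_k.
  by apply: eq_bigr => i _; rewrite [- _ + _]addrC (proj2 (mleadXW k (le_u i))) mcoeffB.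
have sum_c k : (k <= p)%N -> \sum_i c i ^+ k = 0.
  move=> le_k; rewrite (reindex _ (onW_bij _ (enum_val_bij _))) /=.
  rewrite -[RHS](sum_exprD_eq0 (C j0)@_u sum_d cardI le_k).
  by apply: eq_bigr => i _; rewrite /c enum_valK addrC subrK.
have shift_c b s i : c (shift b s i) = mmap1 (shift_weight zeta b s) u * c i.
  by rewrite /c /C -shift_permE -sym_P fourier_shift // mcoeff_diag_scale.
have c_const : forall i i', c i = c i'.
  apply: (@eigenvector_const K _ p c (fun b s => mmap1 (shift_weight zeta b s) u)) => //.
  - exact: prime_gt0.
  - by move=> b s t; rewrite -shift_c /shift /= eqxx.
  - by move=> b s t; rewrite -shift_c /shift /=; case: b.
  - by move=> b s; exact: shift_weightX.
  - by rewrite -[RHS](sum_c 1%N) ?prime_gt0 //; apply: eq_bigr => i _; rewrite expr1.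
  - exact: sum_c.
(* Constancy of [c] kills the leading coefficient of the chosen nonzero difference. *)
have := Dj0; rewrite -mleadc_eq0 -/u mcoeffB.
by have := c_const (enum_val j) (enum_val j0); rewrite /c !enum_valK => ->; rewrite subrr eqxx.
Qed.

(** * Adjoining a nontrivial p-th root of unity *)

(** Strong induction on the size. Whether a proper factor exists is not decidable over a general
    field, hence [classically]. *)
Lemma irreducible_factor (F : fieldType) (q : {poly F}) :
  (1 < size q)%N -> classically (exists2 r, irreducible_poly r & r %| q).
Proof.
have [k] := ubnP (size q); elim: k q => // k IHk q /ltnSE le_qk q_gt1 b Hb.
apply: (@classic_EM (exists2 d : {poly F}, (1 < size d < size q)%N & d %| q)) => -[[d] | no_d].
  case/andP=> d_gt1 lt_dq dq; apply: (IHk d (leq_trans lt_dq le_qk) d_gt1).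
  by case=> r irr_r rd; apply: Hb; exists r => //; exact: dvdp_trans dq.
apply: Hb; exists q => //; split=> // d d_neq1 dq.
have q0 : q != 0 by rewrite -size_poly_gt0 ltnW.
have d0 : d != 0 by apply: contraTneq dq => ->; rewrite dvd0p.
rewrite -dvdp_size_eqp // eqn_leq dvdp_leq //= leqNgt; apply/negP => lt_dq.
by apply: no_d; exists d; rewrite // lt_dq ltn_neqAle eq_sym d_neq1 size_poly_gt0 d0.
Qed.

(** Take a root of an irreducible factor of 1 + X + ... + X^(p-1); it is not 1, because the value at
    1 is [p], nonzero in [F]. *)
Lemma unity_root_extension (F : fieldType) (p : nat) :
  prime p -> p%:R != 0 :> F ->
  classically (exists (L : fieldExtType F) (zeta : L), zeta ^+ p = 1 /\ zeta != 1).
Proof.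
move=> p_prime p0 b Hb; pose q : {poly F} := \poly_(i < p) 1.
have size_q : size q = p by rewrite size_poly_eq ?oner_eq0.
have q_gt1 : (1 < size q)%N by rewrite size_q prime_gt1.
apply: (irreducible_factor q_gt1) => -[r irr_r rq].
have [L _ [z root_z _]] := irredp_FAdjoin irr_r.
have qz : \sum_(i < p) z ^+ i = 0.
  have : root (map_poly (in_alg L) q) z by apply: root_dvdp root_z; rewrite dvdp_map.
  rewrite /root horner_coef size_map_poly size_q => /eqP qz; rewrite -[RHS]qz.
  apply: eq_bigr => i _; rewrite coef_map coef_poly ltn_ord /=.
  by rewrite scale1r mul1r.
apply: Hb; exists L, z; split.
  by apply/eqP; rewrite -subr_eq0 subrX1 qz mulr0.
apply: contraNneq p0 => z1; rewrite -(fmorph_eq0 (in_alg L)) rmorph_nat -qz z1.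
by under [X in _ == X]eq_bigr do rewrite expr1n; rewrite sumr_const card_ord.
Qed.

(** * The trace as a sum of conjugates *)

(** The columns of the Vandermonde matrix are eigenvectors of [M], and that matrix is invertible. *)
Lemma mxtrace_vandermonde_diag (K : fieldType) (d n : nat) (a z : 'I_n -> K) (M : 'M_d) :
  d = n -> injective a ->
  (forall r j, \sum_s M r s * a j ^+ s = z j * a j ^+ r) -> \tr M = \sum_j z j.
Proof.
move=> eq_dn; subst d => inj_a MV; pose V := Vandermonde n (\row_j a j).
have V_unit : V \in unitmx.
  rewrite unitmxE unitfE det_Vandermonde; apply/prodf_neq0 => j _.
  apply/prodf_neq0 => k ltjk; rewrite !mxE subr_eq0 (inj_eq inj_a).
  by rewrite -val_eqE /= gtn_eqF.
have /(canRL (mulmxK V_unit)) -> : M *m V = V *m diag_mx (\row_j z j).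
  apply/matrixP => r j; rewrite mul_mx_diag !mxE mulrC -MV.
  by apply: eq_bigr => s _; rewrite !mxE.
rewrite mxtrace_mulC mulmxA mulVmx // mul1mx mxtrace_diag.
by apply: eq_bigr => j _; rewrite mxE.
Qed.

Section Trace.

Variables (F : fieldType) (n : nat) (i : 'I_n).
Local Notation L := (stabField F i).
Local Notation conj j := (ratfun_act (tperm i j)).

Definition stab_powers : (\dim {:L}).-tuple L := [tuple stabVar F i ^+ r | r < \dim {:L}].

Lemma stab_powers_basis : basis_of {:L} stab_powers.
Proof.
rewrite basisEdim size_tuple leqnn andbT; apply/subvP => z _.
rewrite -[z]stab_coordK; apply: memv_suml => r _; apply: memvZ.
have lt_r : (r < \dim {:L})%N by rewrite dim_stabField.
by apply: memv_span; apply/mapP; exists (Ordinal lt_r); rewrite ?mem_enum.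
Qed.

(** Expand z times a power of x_i in the basis of powers and apply the j-th conjugation, which fixes
    the coefficients: the powers of x_j form an eigenvector for the j-th conjugate of z. *)
Lemma fieldTrace_sum_conj (z : L) :
  symField_val (fieldTrace z) = \sum_j conj j (stabField_val z).
Proof.
rewrite /fieldTrace (lftrace_basis _ stab_powers_basis).
set M := mxof _ _ _.
rewrite -(@mxtrace_vandermonde_diag _ _ _ (ratvar F (n:=n)) _ (map_mx (@symField_val F n) M)).
- by rewrite trace_map_mx.
- exact: dim_stabField.
- exact: ratvar_inj.
move=> r j.
have nth_pow (s : 'I_(\dim {:L})) : stab_powers`_s = stabVar F i ^+ s.
  by rewrite -tnth_nth tnth_mktuple.
have pow_conj s : conj j (stabField_val (stabVar F i ^+ s)) = ratvar F j ^+ s.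
  by rewrite !rmorphXn /= ratfun_act_var tpermL.
have conjZ k (w : L) : conj j (stabField_val (k *: w)) = symField_val k * conj j (stabField_val w).
  by rewrite val_sym_scale rmorphM /= symField_fixed.
have := hom_vecof stab_powers stab_powers_basis (amull z) (delta_mx 0 r).
rewrite vecof_delta -rowE lfunE /= nth_pow => /(congr1 (conj j \o @stabField_val F n i)).
rewrite /= rmorphM /= pow_conj => ->; rewrite /vecof !raddf_sum.
apply: eq_bigr => s _; rewrite nth_pow [RHS]conjZ.
by rewrite pow_conj !mxE.
Qed.

End Trace.

(** * Numerators of the conjugates over a symmetric denominator *)

Section Conjugates.

Variables (F : fieldType) (n : nat) (i : 'I_n).
Local Notation L := (stabField F i).
Local Notation conj j := (ratfun_act (tperm i j)).

Lemma conj_common_denominator (z : L) :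
  exists (N : {mpoly F[n]}) (P : 'I_n -> {mpoly F[n]}),
    [/\ N != 0, forall s j, msym s (P j) = P (s j)
      & forall j, conj j (stabField_val z) = (P j)%:F / N%:F].
Proof.
have [A [B [B0 zE]]] := ratfunP (stabField_val z).
(* The product of all the S_n-translates of the denominator is symmetric. The new numerator [R] is
   then fixed by the stabiliser of [i], so its image under [s] depends only on [s i]. *)
pose N := \prod_(s : 'S_n) msym s B.
have N0 : N != 0 by apply/prodf_neq0 => s _; rewrite msym_eq0.
have symN s : msym s N = N.
  rewrite rmorph_prod /= [RHS](reindex_inj (mulIg s)) /=.
  by apply: eq_bigr => t _; rewrite msymMm.
pose B' := \prod_(s : 'S_n | s != 1%g) msym s B; pose R := A * B'.
have B'0 : B' != 0 by apply/prodf_neq0 => s _; rewrite msym_eq0.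
have NE : N = B * B' by rewrite /N (bigD1 1%g) //= msym1m.
have zNR : stabField_val z = R%:F / N%:F.
  by rewrite zE NE !tofracM -mulf_div divff ?mulr1 // tofrac_eq0.
have conjE s : ratfun_act s (stabField_val z) = (msym s R)%:F / N%:F.
  by rewrite zNR ratfun_actE // symN.
have fixR (s : 'S_n) : s i = i -> msym s R = R.
  move=> si; apply/eqP; rewrite -tofrac_eq; apply/eqP.
  apply: (mulIf (x := (N%:F)^-1)); first by rewrite invr_eq0 tofrac_eq0.
  by rewrite -conjE stabField_fixed.
exists N, (fun j => msym (tperm i j) R); split=> // s j.
rewrite -msymMm -[(tperm i j * s)%g](mulgKV (tperm i (s j))) msymMm fixR //.
by rewrite !permM tpermL tpermV tpermR.
Qed.

Lemma conj_eq_sym (z : L) :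
  (forall j, conj j (stabField_val z) = stabField_val z) ->
  stabField_val z \in invRatfun [set: 'S_n].
Proof.
move=> conj_z; apply/invRatfunP => s _.
rewrite -[s](mulgKV (tperm i (s i))) ratfun_actM stabField_fixed ?conj_z //.
by rewrite permM tpermV tpermR.
Qed.

End Conjugates.

Theorem theorem3 (F : fieldType) (m p n : nat) (x1 : 'I_n) :
  2%N \in [pchar F] -> (1 <= m)%N -> prime p -> odd p ->
  n = (2 * p ^ m)%N -> x1 = 0%N :> nat ->
  ~ exists y : stabField F x1,
      stabField_val y \notin invRatfun [set: 'S_n] /\
      (forall k : nat, (1 <= k <= p)%N -> fieldTrace (y ^+ k) = 0).
Proof.
move=> c2 _ p_prime odd_p nE _ [y [/negP y_notin tr_y]].
have p0 : p%:R != 0 :> F by rewrite (pchar2_natr p c2) odd_p oner_eq0.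
(* Turning the goal into the boolean [false] makes the [classically] statement usable. *)
apply: notF; apply: (unity_root_extension p_prime p0) => -[L [zeta [zetaX zeta1]]].
exfalso; apply: y_notin; apply: conj_eq_sym.
have {nE} nE : n = #|{: bool * 'rV['F_p]_m}|.
  by rewrite nE card_prod card_bool card_mx card_Fp // mul1n.
subst n; have [N [P [N0 symP conjP]]] := conj_common_denominator y.
have N0' : N%:F != 0 by rewrite tofrac_eq0.
have c2L : 2%N \in [pchar L].
  exact: (rmorph_pchar (in_alg L) c2).
have sumP k : (1 <= k <= p)%N -> \sum_j P j ^+ k = 0.
  move=> /tr_y /(congr1 (@symField_val F _)).
  rewrite fieldTrace_sum_conj raddf0 => sum0; apply/eqP; rewrite -tofrac_eq0.
  have : \sum_j (P j)%:F ^+ k / N%:F ^+ k = 0.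
    rewrite -[RHS]sum0; apply: eq_bigr => j _.
    by rewrite !rmorphXn /= conjP expr_div_n.
  rewrite -mulr_suml => /eqP; rewrite mulf_eq0 invr_eq0 expf_eq0 (negPf N0') andbF orbF.
  by rewrite raddf_sum /=; under [X in _ -> X == _]eq_bigr do rewrite tofracXn.
move=> j; rewrite conjP -[RHS](ratfun_act1 (stabField_val y)) -(tperm1 x1) conjP.
by rewrite (equivariant_power_sums_const (in_alg L) c2L p_prime odd_p zetaX zeta1 symP sumP j x1).
Qed.
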